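(* Let $n_0$ be an integer and let $\boldsymbol\beta=(\beta(n))_{n\ge n_0}$ be a strictly increasing sequence of integers $\ge n_0$ such that the set of integers $\ge n_0$ not in $\boldsymbol\beta$ is infinite. Then the Aronson transform of $\boldsymbol\beta$ exists and is unique. That is, the set of strictly increasing sequences $\boldsymbol\alpha=(\alpha(n))_{n\ge n_0}$ of integers $\ge n_0$ such that for every $n\ge n_0$, $n$ is a term of $\boldsymbol\alpha$ if and only if $\alpha(n)$ is a term of $\boldsymbol\beta$, is nonempty and has a lexicographically least element. Equivalently, choosing each $\alpha(n)$ (in order $n=n_0,n_0+1,\dots$) as the smallest integer $\ge n_0$ and greater than $\alpha(n-1)$ that is consistent with this condition never gets stuck and yields a well-defined infinite sequence satisfying the condition.
   Context: The Aronson transform of $\boldsymbol\beta$ is the sequence $\boldsymbol\alpha$ in which $\alpha(n)$ is the smallest integer greater than $\alpha(n-1)$ (and $\ge n_0$) consistent with the condition ''$n$ is in $\boldsymbol\alpha$ if and only if $\alpha(n)$ is in $\boldsymbol\beta$''. *)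

(* Defs.v *)
From mathcomp Require Import all_boot all_order all_algebra.
From mathcomp Require Import all_classical.
Set Implicit Arguments.
Unset Strict Implicit.
Unset Printing Implicit Defensive.
Import Order.TTheory GRing.Theory Num.Theory.
Local Open Scope classical_set_scope.
Local Open Scope ring_scope.

(* A sequence (a(n))_{n >= n0} is a function a : int -> int of
   which only the values at n >= n0 matter; two functions denote the same
   sequence when they are related by eq_from n0. *)

Definition eq_from (n0 : int) (a b : int -> int) : Prop :=
  forall n, n0 <= n -> a n = b n.

Definition increasing_seq (n0 : int) (a : int -> int) : Prop :=
  (forall n, n0 <= n -> n0 <= a n) /\
  (forall m n : int, n0 <= m -> m < n -> a m < a n).

Definition terms (n0 : int) (a : int -> int) : set int :=
  a @` [set n | n0 <= n].

Definition solutions (n0 : int) (beta : int -> int) : set (int -> int) :=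
  [set a | increasing_seq n0 a /\
     forall n, n0 <= n -> (terms n0 a n <-> terms n0 beta (a n))].

Definition lex_lt (n0 : int) (a b : int -> int) : Prop :=
  exists n, [/\ n0 <= n, forall m, n0 <= m < n -> a m = b m & a n < b n].

Definition lex_least (n0 : int) (S : set (int -> int)) (a : int -> int) : Prop :=
  S a /\ forall b, S b -> eq_from n0 a b \/ lex_lt n0 a b.

Definition terms_upto (n0 : int) (a : int -> int) (n : int) : set int :=
  a @` [set k | n0 <= k <= n].

(* The finite prefix a(n0), ..., a(n) does not contradict the condition
   "m is a term of a iff a(m) is a term of beta" at any m <= n. Whether m is a
   term of the whole sequence is already settled when m occurs in the prefix
   (it is) and when m <= a(n) does not occur there (it is not, since all later
   terms exceed a(n)); otherwise the prefix imposes nothing at m. *)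
Definition consistent_upto (n0 : int) (beta a : int -> int) (n : int) : Prop :=
  forall m, n0 <= m <= n ->
    (terms_upto n0 a n m -> terms n0 beta (a m)) /\
    (m <= a n -> ~ terms_upto n0 a n m -> ~ terms n0 beta (a m)).

(* The admissible values for a(n), given a(n0), ..., a(n - 1). *)
Definition candidates (n0 : int) (beta a : int -> int) (n : int) : set int :=
  [set v | [/\ n0 <= v, n0 < n -> a (n - 1) < v
             & consistent_upto n0 beta [eta a with n |-> v] n]].

Definition greedy_choice (n0 : int) (beta a : int -> int) (n v : int) : Prop :=
  candidates n0 beta a n v /\ lbound (candidates n0 beta a n) v.

Definition aronson_transform (n0 : int) (beta a : int -> int) : Prop :=
  forall n, n0 <= n -> greedy_choice n0 beta a n (a n).

(* Main.v *)
Require Import Defs.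
From mathcomp Require Import all_boot all_order all_algebra.
From mathcomp Require Import all_classical.
From mathcomp Require Import zify.
Set Implicit Arguments.
Unset Strict Implicit.
Unset Printing Implicit Defensive.
Import Order.TTheory GRing.Theory Num.Theory.
Local Open Scope classical_set_scope.
Local Open Scope ring_scope.

(* A strictly increasing a satisfies m <= a m, so whether m is a term of a is
   decided by a(n0), ..., a(m). The condition at m therefore involves only that
   prefix, and a prefix satisfying it extends by one term: if n already occurs,
   take a large term of beta, otherwise a large non-term of beta. So the greedy
   construction never gets stuck; and a solution first differing from the
   greedy sequence at n has there a candidate, hence a larger value. *)

(** * Integers bounded below: induction, least elements, unboundedness *)

Lemma int_strong_ind (n0 : int) (P : int -> Prop) :
  (forall n, n0 <= n -> (forall m, n0 <= m < n -> P m) -> P n) ->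
  forall n, n0 <= n -> P n.
Proof.
move=> IH n hn.
have [k hk] : exists k : nat, n < n0 + k%:Z by exists (`|n - n0|.+1)%N; lia.
elim: k n hn hk => [|k IHk] n hn hk; first by lia.
by apply: IH => // m hm; apply: IHk; lia.
Qed.

Lemma int_least (n0 : int) (P : int -> Prop) (n : int) :
  n0 <= n -> P n ->
  exists m, [/\ n0 <= m, P m & forall k, n0 <= k < m -> ~ P k].
Proof.
move=> hn Pn; apply: contrapT => nex.
suff: ~ P n by [].
move: n hn {Pn}; apply: int_strong_ind => n hn IH Pn.
by apply: nex; exists n.
Qed.

Lemma infinite_int_unbounded (n0 : int) (A : set int) :
  infinite_set A -> (forall m, A m -> n0 <= m) ->
  forall x, exists2 v, A v & x < v.
Proof.
move=> infA geA x; apply: contrapT => nex; apply: infA.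
(* If no element of [A] exceeded [x], then [A] would lie between [n0] and [x], inside the image of
   finitely many naturals. *)
apply: (@sub_finite_set _ _ ((fun i : nat => n0 + i%:Z) @` `I_(`|x - n0|.+1))).
  move=> m Am; have := geA _ Am => hm.
  have hx : m <= x by rewrite leNgt; apply/negP => h; apply: nex; exists m.
  by exists `|m - n0|%N => /=; lia.
exact/finite_image/finite_II.
Qed.

(** * Strictly increasing prefixes *)

Definition increasing_upto (n0 : int) (a : int -> int) (n : int) : Prop :=
  forall m, n0 <= m <= n -> n0 <= a m /\ (n0 < m -> a (m - 1) < a m).

Lemma increasing_upto_lt n0 a n k l :
  increasing_upto n0 a n -> n0 <= k -> k < l -> l <= n -> a k < a l.
Proof.
move=> inc hk hkl; have hl : n0 <= l by lia.
move: l hl hkl; apply: int_strong_ind => l hl IH hkl hln.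
have [_] := inc l ltac:(lia); move=> /(_ ltac:(lia)) hlt.
have [kl|kl] : k = l - 1 \/ k < l - 1 by lia.
  by rewrite kl.
by have := IH (l - 1) ltac:(lia) kl ltac:(lia); lia.
Qed.

Lemma increasing_upto_ge n0 a n k :
  increasing_upto n0 a n -> n0 <= k -> k <= n -> k <= a k.
Proof.
move=> inc hk; move: k hk; apply: int_strong_ind => k hk IH hkn.
have [h1 h2] := inc k ltac:(lia).
have [->//|hlt] : k = n0 \/ n0 < k by lia.
  by have [] := inc n0 ltac:(lia).
by have := h2 hlt; have := IH (k - 1) ltac:(lia) ltac:(lia); lia.
Qed.

Lemma increasing_seq_upto n0 a n :
  increasing_seq n0 a -> increasing_upto n0 a n.
Proof.
by move=> [h1 h2] m hm; split=> [|?]; [apply: h1|apply: h2]; lia.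
Qed.

Lemma increasing_upto_seq n0 a :
  (forall n, n0 <= n -> increasing_upto n0 a n) -> increasing_seq n0 a.
Proof.
move=> inc; split=> [n hn|m n hm hmn].
  by have [] := inc n hn n ltac:(lia).
by apply: (increasing_upto_lt (inc n ltac:(lia))).
Qed.

(** * The condition at [m] depends only on the prefix up to [m] *)

Lemma terms_upto_stable n0 a n m :
  increasing_upto n0 a n -> m <= n ->
  terms_upto n0 a n m <-> terms_upto n0 a m m.
Proof.
move=> inc hm; split=> -[k /= hk akm]; exists k => //=; last by lia.
(* An occurrence [a k = m] has [k <= a k = m], so indices beyond [m] contribute nothing. *)
by have := increasing_upto_ge inc (k := k) ltac:(lia) ltac:(lia); lia.
Qed.

Lemma terms_termsE n0 a m :
  increasing_seq n0 a -> terms n0 a m <-> terms_upto n0 a m m.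
Proof.
move=> inc; split=> -[k /= hk akm]; exists k => //=; last by lia.
by have := increasing_upto_ge (increasing_seq_upto (n := k) inc) hk (lexx _); lia.
Qed.

(** The guard [m <= a n] always holds, since [m <= a m <= a n]. Hence no membership is left open by
    the prefix, and the two implications merge into an equivalence. *)
Lemma consistent_uptoE n0 beta a n :
  increasing_upto n0 a n ->
  consistent_upto n0 beta a n <->
  forall m, n0 <= m <= n -> (terms_upto n0 a m m <-> terms n0 beta (a m)).
Proof.
move=> inc; split=> cons m hm; have st := terms_upto_stable inc (m := m) ltac:(lia).
- have [h1 h2] := cons m hm; split=> [/st//|hb].
  apply: contrapT => /(contra_not (proj1 st)) nt; apply: h2 => //.
  have := increasing_upto_ge inc (k := m) ltac:(lia) ltac:(lia).
  have [<-//|?] : m = n \/ m < n by lia.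
  by have := increasing_upto_lt inc (k := m) (l := n) ltac:(lia) ltac:(lia) ltac:(lia); lia.
- split=> [/st /(cons m hm)//|_ nt /(cons m hm) /st]; exact: nt.
Qed.

Lemma eq_terms_upto n0 a b n :
  (forall m, n0 <= m <= n -> a m = b m) ->
  terms_upto n0 a n = terms_upto n0 b n.
Proof.
move=> ab; apply/seteqP; split=> m [k /= hk <-]; exists k => //=.
  by rewrite ab.
by rewrite -ab.
Qed.

Lemma eq_consistent_upto n0 beta a b n :
  n0 <= n -> (forall m, n0 <= m <= n -> a m = b m) ->
  consistent_upto n0 beta a n -> consistent_upto n0 beta b n.
Proof.
move=> hn ab cons m hm.
by rewrite -(eq_terms_upto ab) -(ab m hm) -(ab n ltac:(lia)); apply: cons.
Qed.

(** The candidate overwrites the value at [n], and consistency looks no further. This locality lets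
    a choice be transferred between sequences that agree so far. *)
Lemma eq_candidates n0 beta a b n :
  n0 <= n -> (forall m, n0 <= m < n -> a m = b m) ->
  candidates n0 beta a n = candidates n0 beta b n.
Proof.
move=> hn; wlog suff sub : a b / (forall m, n0 <= m < n -> a m = b m) ->
    candidates n0 beta a n `<=` candidates n0 beta b n.
  move=> ab; apply/seteqP; split; apply: sub => // m hm.
  by rewrite ab.
move=> ab v [hv hlt cons]; split=> // [h|].
  by rewrite -ab; [exact: hlt | lia].
apply: eq_consistent_upto cons => //= m hm.
by case: eqP => // mn; apply: ab; lia.
Qed.

(** * Solutions are the sequences whose every entry is a candidate *)

Lemma candidates_self n0 beta a n :
  n0 <= n ->
  candidates n0 beta a n (a n) <->
  [/\ n0 <= a n, n0 < n -> a (n - 1) < a n & consistent_upto n0 beta a n].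
Proof.
move=> hn; split=> -[h1 h2 cons]; split=> //;
  by apply: eq_consistent_upto cons => //= m hm; case: eqP => // ->.
Qed.

Lemma solutions_candidate n0 beta a n :
  solutions n0 beta a -> n0 <= n -> candidates n0 beta a n (a n).
Proof.
move=> [inc sol] hn; apply/candidates_self => //.
have incn := increasing_seq_upto (n := n) inc.
have [h1 h2] := incn n ltac:(lia); split=> //.
apply/(consistent_uptoE _ incn) => m hm.
by rewrite -terms_termsE //; apply: sol; lia.
Qed.

Lemma candidates_solution n0 beta a :
  (forall n, n0 <= n -> candidates n0 beta a n (a n)) -> solutions n0 beta a.
Proof.
move=> cand; have incn n : n0 <= n -> increasing_upto n0 a n.
  move=> hn m hm.
  by have /candidates_self[] := cand m ltac:(lia); last split; first lia.
have inc := increasing_upto_seq incn; split=> // n hn.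
rewrite terms_termsE //.
have /candidates_self[//|_ _ /(consistent_uptoE _ (incn n hn))] := cand n hn.
by apply; lia.
Qed.

(** * Uniqueness and lexicographic minimality of the greedy sequence *)

Lemma greedy_choice_unique n0 beta a n v w :
  greedy_choice n0 beta a n v -> greedy_choice n0 beta a n w -> v = w.
Proof.
move=> [cv lv] [cw lw]; apply: le_anti.
by rewrite (lv w cw) (lw v cv).
Qed.

Lemma eq_greedy_choice n0 beta a b n v :
  n0 <= n -> (forall m, n0 <= m < n -> a m = b m) ->
  greedy_choice n0 beta a n v -> greedy_choice n0 beta b n v.
Proof. by move=> hn ab; rewrite /greedy_choice (eq_candidates _ hn ab). Qed.

Lemma aronson_transform_unique n0 beta a b :
  aronson_transform n0 beta a -> aronson_transform n0 beta b -> eq_from n0 a b.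
Proof.
move=> ha hb n; move: n; apply: int_strong_ind => n hn IH.
apply: greedy_choice_unique (hb n hn).
exact: eq_greedy_choice (ha n hn).
Qed.

Lemma aronson_transform_solution n0 beta a :
  aronson_transform n0 beta a -> solutions n0 beta a.
Proof. by move=> ha; apply: candidates_solution => n /ha[]. Qed.

Lemma aronson_transform_lex_least n0 beta a :
  aronson_transform n0 beta a -> lex_least n0 (solutions n0 beta) a.
Proof.
move=> ha; split; first exact: aronson_transform_solution.
move=> b solb; have [|nab] := pselect (eq_from n0 a b); first by left.
right; have [n hn nabn] : exists2 n, n0 <= n & a n <> b n.
  apply: contrapT => nex; apply: nab => n hn.
  by apply: contrapT => nabn; apply: nex; exists n.
have [m [hm nabm mmin]] := int_least (P := fun n => a n <> b n) hn nabn.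
have eqab k : n0 <= k < m -> a k = b k by move=> /mmin /contrapT.
exists m; split=> //; rewrite lt_neqAle; apply/andP; split; first exact/eqP.
have [_] := ha m hm; apply.
(* Since [a] and [b] agree below [m], the value [b m] competes with [a m] in the same candidate
   set. *)
by rewrite (eq_candidates _ hm eqab); apply: solutions_candidate.
Qed.

(** At the smaller of the two witnessing indices, one comparison forces equality and the other a
    strict inequality; if the indices coincide, the inequalities are opposite. *)
Lemma lex_lt_asym n0 a b : lex_lt n0 a b -> ~ lex_lt n0 b a.
Proof.
move=> [n [hn eqn ltn]] [m [hm eqm ltm]].
have [h|[h|h]] : n < m \/ m < n \/ n = m by lia.
- by have := eqm n ltac:(lia); lia.
- by have := eqn m ltac:(lia); lia.
- by subst m; lia.
Qed.

Lemma lex_least_unique n0 S a b :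
  lex_least n0 S a -> lex_least n0 S b -> eq_from n0 a b.
Proof.
move=> [Sa la] [Sb lb]; have [//|ab] := la b Sb.
have [ba n hn|ba] := lb a Sa; first by rewrite ba.
by have := lex_lt_asym ab ba.
Qed.

(** * Existence of the greedy sequence *)

Section Existence.
Variables (n0 : int) (beta : int -> int).
Hypothesis hbeta : increasing_seq n0 beta.
Hypothesis hcompl : infinite_set [set m : int | n0 <= m /\ ~ terms n0 beta m].

Lemma candidates_nonempty a n :
  n0 <= n -> (forall m, n0 <= m < n -> candidates n0 beta a m (a m)) ->
  candidates n0 beta a n !=set0.
Proof.
(* Exceeding [a (n - 1)] keeps the prefix increasing; exceeding [n] keeps [v] from making [n] a term
   itself. For [n = n0] the value [a (n - 1)] is arbitrary and only pushes [v] higher. *)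
move=> hn cand; pose x := Num.max (a (n - 1)) n.
have [v hxv vP] : exists2 v, x < v &
    (terms_upto n0 a (n - 1) n <-> terms n0 beta v).
  have [tn|ntn] := pselect (terms_upto n0 a (n - 1) n).
    (* The index [k] is large enough because [x < k <= beta k]. *)
    pose k := Num.max n0 (x + 1); exists (beta k).
      have := increasing_upto_ge (increasing_seq_upto (n := k) hbeta) (k := k)
        ltac:(lia) (lexx _); lia.
    by split=> // _; exists k => //=; lia.
  have [v [_ nv] hxv] := infinite_int_unbounded hcompl (fun m => @proj1 _ _) x.
  by exists v.
exists v; pose b := [eta a with n |-> v].
have ba m : n0 <= m < n -> b m = a m by move=> hm /=; case: eqP => //; lia.
have bn : b n = v by rewrite /= eqxx.
have candP m : n0 <= m < n ->
    [/\ n0 <= a m, n0 < m -> a (m - 1) < a m & consistent_upto n0 beta a m].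
  by move=> hm; apply/candidates_self; [lia | exact: cand].
have incb : increasing_upto n0 b n.
  move=> m hm; have [->|hmn] : m = n \/ m < n by lia.
    rewrite bn; split=> [|h]; first by lia.
    by rewrite ba; lia.
  have [h1 h2 _] := candP m ltac:(lia).
  rewrite (ba m); last by lia.
  by split=> // h; rewrite ba; [exact: h2 | lia].
split=> [|h|]; [lia..|].
apply/(consistent_uptoE _ incb) => m hm.
have [->|hmn] : m = n \/ m < n by lia.
  (* Since [b n = v > n], an occurrence of [n] in the extended prefix has index below [n], where [b]
     is [a]. *)
  rewrite bn -vP; split=> -[k /= hk bkn].
    have kn : k <> n by move=> kn; move: bkn; rewrite kn eqxx; lia.
    by exists k => /=; [lia | rewrite -bkn; case: eqP].
  by exists k => /=; [lia | rewrite -bkn; case: eqP => //; lia].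
have inca : increasing_upto n0 a m.
  by move=> k hk; have [] := candP k ltac:(lia).
have [_ _ /(consistent_uptoE _ inca) cons] := candP m ltac:(lia).
rewrite (ba m); last by lia.
rewrite (eq_terms_upto (b := a)); last by move=> k hk; apply: ba; lia.
by apply: cons; lia.
Qed.

Lemma greedy_choice_exists a n :
  n0 <= n -> (forall m, n0 <= m < n -> greedy_choice n0 beta a m (a m)) ->
  exists v, greedy_choice n0 beta a n v.
Proof.
move=> hn greedy.
have [v cv] := candidates_nonempty hn (fun m hm => (greedy m hm).1).
have hv : n0 <= v by case: cv.
have [w [_ cw wmin]] := int_least (P := candidates n0 beta a n) hv cv.
exists w; split=> // u cu; rewrite leNgt; apply/negP => huw.
by apply: (wmin u) => //; case: cu; lia.
Qed.

(** Stage [k] has chosen the [k] entries at indices [n0] to [n0 + k - 1]; elsewhere it is still the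
    arbitrary start [id]. The default [0] of [xget] is never taken, as a greedy choice always
    exists. *)
Fixpoint greedy_prefix (k : nat) : int -> int :=
  if k is j.+1 then
    let a := greedy_prefix j in
    [eta a with n0 + j%:Z |-> xget 0 (greedy_choice n0 beta a (n0 + j%:Z))]
  else id.

Lemma greedy_prefixD j k m :
  m < n0 + j%:Z -> greedy_prefix (k + j) m = greedy_prefix j m.
Proof.
by move=> hm; elim: k => // k IH; rewrite addSn /= -IH; case: eqP => //; lia.
Qed.

Lemma greedy_prefixP k m :
  n0 <= m < n0 + k%:Z ->
  greedy_choice n0 beta (greedy_prefix k) m (greedy_prefix k m).
Proof.
elim: k m => [|k IH] m hm; first by lia.
set a := greedy_prefix k in IH *.
have eqa l : l < n0 + k%:Z -> a l = greedy_prefix k.+1 l.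
  by move=> hl; exact: esym (greedy_prefixD 1 hl).
(* The new stage changes only index [n0 + k], and a choice at [m <= n0 + k] reads only entries below
   [m], so it may be judged in [a]. *)
apply: (eq_greedy_choice (a := a)); [by lia | by move=> l hl; apply: eqa; lia|].
have [hmk|mk] : m < n0 + k%:Z \/ m = n0 + k%:Z by lia.
  by rewrite -eqa //; apply: IH; lia.
rewrite mk /= eqxx -/a.
by apply: xgetPex; apply: greedy_choice_exists => //; lia.
Qed.

Lemma aronson_transform_exists : exists a, aronson_transform n0 beta a.
Proof.
(* Diagonal limit: entry [n] is read at the first stage that has chosen it, and later stages
   preserve it. *)
exists (fun n => greedy_prefix `|n - n0|.+1 n) => n hn.
apply: (eq_greedy_choice (a := greedy_prefix `|n - n0|.+1)) => //.
  move=> m hm.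
  have -> : (`|n - n0|.+1 = (`|n - n0| - `|m - n0|) + `|m - n0|.+1)%N by lia.
  by apply: greedy_prefixD; lia.
by apply: greedy_prefixP; lia.
Qed.

End Existence.

Theorem theorem2 (n0 : int) (beta : int -> int)
  (hbeta : increasing_seq n0 beta)
  (hcompl : infinite_set [set m : int | n0 <= m /\ ~ terms n0 beta m]) :
  [/\ solutions n0 beta !=set0,
      (* the greedy construction never gets stuck *)
      forall (a : int -> int) (n : int), n0 <= n ->
        (forall m : int, n0 <= m < n -> greedy_choice n0 beta a m (a m)) ->
        exists v, greedy_choice n0 beta a n v
    & exists alpha : int -> int,
      [/\ aronson_transform n0 beta alpha,
          solutions n0 beta alpha,
          lex_least n0 (solutions n0 beta) alpha,
          forall a, aronson_transform n0 beta a -> eq_from n0 a alpha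
        & forall a, lex_least n0 (solutions n0 beta) a -> eq_from n0 a alpha]].
Proof.
have [alpha ha] := aronson_transform_exists hbeta hcompl.
have sola := aronson_transform_solution ha.
have leasta := aronson_transform_lex_least ha.
split; [by exists alpha | exact: greedy_choice_exists |].
exists alpha; split=> // a h.
  exact: aronson_transform_unique ha.
exact: lex_least_unique leasta.
Qed.
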